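(* Let $G$ be a Garside group of finite type (with a fixed finite type Garside structure $(G,P,\Delta)$). If $x\in G$ is conjugate to a rigid element, then $\mathrm{SC}(x)$ is the set of rigid conjugates of $x$, that is, $\mathrm{SC}(x)=\{y\in x^G \mid y \text{ is rigid}\}$.
   Context: Garside structure: a group $G$ with a submonoid $P$ (the positive elements), $P\cap P^{-1}=\{1\}$, and an element $\Delta\in P$ such that: (G1) the partial order $a\preccurlyeq b \Leftrightarrow a^{-1}b\in P$ on $G$ is a lattice order, with greatest common divisor $a\wedge b$ and least common multiple $a\vee b$; (G2) the set $[1,\Delta]=\{a\in G\mid 1\preccurlyeq a\preccurlyeq\Delta\}$ of simple elements generates $G$; (G3) $\Delta^{-1}P\Delta=P$; (G4) for every $x\in P\setminus\{1\}$, $\|x\|=\sup\{k\mid \exists a_1,\dots,a_k\in P\setminus\{1\},\ x=a_1\cdots a_k\}<\infty$. It is of finite type if $[1,\Delta]$ is finite; a Garside group of finite type is a group admitting such a finite type structure. Notation: $x^{\alpha}=\alpha^{-1}x\alpha$; $x^G$ is the conjugacy class of $x$. $\inf(x)$ is the maximal integer $p$ with $\Delta^p\preccurlyeq x$, $\sup(x)$ is the minimal integer $q$ with $x\preccurlyeq\Delta^q$. Preferred prefix: $\mathfrak p(x)=(x\Delta^{-\inf(x)})\wedge(x^{-1}\Delta^{\sup(x)})\wedge\Delta$. Cyclic sliding: $\mathfrak s(x)=x^{\mathfrak p(x)}=\mathfrak p(x)^{-1}x\,\mathfrak p(x)$. An element $x$ is rigid if $\mathfrak p(x)=1$. The set of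 sliding circuits of $x$ is $\mathrm{SC}(x)=\{y\in x^G\mid \mathfrak s^m(y)=y \text{ for some } m\ge 1\}$. *)

(* Defs.v *)
From mathcomp Require Import all_boot all_order all_algebra.
From mathcomp Require Import classical_sets cardinality.

Set Implicit Arguments.
Unset Strict Implicit.
Unset Printing Implicit Defensive.

Local Open Scope group_scope.
Local Open Scope classical_set_scope.

Definition submonoid (G : groupType) (P : set G) : Prop :=
  P 1 /\ forall a b, P a -> P b -> P (a * b).

Definition subgroup (G : groupType) (H : set G) : Prop :=
  H 1 /\ forall a b, H a -> H b -> H (a / b).

Definition expgz (G : groupType) (a : G) (p : int) : G :=
  match p with Posz n => a ^+ n | Negz n => a ^- n.+1 end.

Definition conj_class (G : groupType) (x : G) : set G := range (conjg x).

Definition preceq (G : groupType) (P : set G) (a b : G) : Prop := P (a^-1 * b).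

Definition is_gcd (G : groupType) (P : set G) (a b d : G) : Prop :=
  [/\ preceq P d a, preceq P d b &
      forall c, preceq P c a -> preceq P c b -> preceq P c d].

Definition is_lcm (G : groupType) (P : set G) (a b m : G) : Prop :=
  [/\ preceq P a m, preceq P b m &
      forall c, preceq P a c -> preceq P b c -> preceq P m c].

Definition simples (G : groupType) (P : set G) (Delta : G) : set G :=
  [set a | preceq P 1 a /\ preceq P a Delta].

Definition factorization_lengths (G : groupType) (P : set G) (x : G) : set nat :=
  [set k | exists s : seq G,
     [/\ size s = k, (forall a, a \in s -> P a /\ a <> 1) &
         x = \prod_(a <- s) a]].

(* That preceq is a partial order follows from the first two fields, so the
   lattice condition amounts to the existence of gcds and lcms.  In the last field,
   finiteness of the supremum of the lengths is boundedness. *)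
Record garside (G : groupType) (P : set G) (Delta : G) : Prop := Garside {
  garside_submonoid : submonoid P;
  garside_pointed : P `&` [set a | P a^-1] = [set 1];
  garside_Delta : P Delta;
  garside_gcd : forall a b, exists d, is_gcd P a b d;
  garside_lcm : forall a b, exists m, is_lcm P a b m;
  garside_generate : smallest (@subgroup G) (simples P Delta) = setT;
  garside_conj_Delta : [set a ^ Delta | a in P] = P;
  garside_norm : forall x, P x -> x <> 1 ->
    exists N : nat, forall k, factorization_lengths P x k -> (k <= N)%N
}.

Definition garside_finite_type (G : groupType) (P : set G) (Delta : G) : Prop :=
  garside P Delta /\ finite_set (simples P Delta).

(* In a Garside structure the gcd is unique by antisymmetry; the default value 1
   is never used. *)
Definition ggcd (G : groupType) (P : set G) (a b : G) : G :=
  xget 1 [set d | is_gcd P a b d].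

(* The extremal integers exist and are unique in a Garside structure unless
   Delta = 1.  In that case G is trivial, and the default value 0 is harmless. *)
Definition ginf (G : groupType) (P : set G) (Delta x : G) : int :=
  xget 0%R [set p : int | preceq P (expgz Delta p) x /\
    forall q : int, preceq P (expgz Delta q) x -> (q <= p)%R].

Definition gsup (G : groupType) (P : set G) (Delta x : G) : int :=
  xget 0%R [set q : int | preceq P x (expgz Delta q) /\
    forall p : int, preceq P x (expgz Delta p) -> (q <= p)%R].

Definition preferred_prefix (G : groupType) (P : set G) (Delta x : G) : G :=
  ggcd P (ggcd P (x * expgz Delta (- ginf P Delta x)%R)
               (x^-1 * expgz Delta (gsup P Delta x)))
        Delta.

Definition cyclic_sliding (G : groupType) (P : set G) (Delta x : G) : G :=
  x ^ preferred_prefix P Delta x.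

Definition rigid (G : groupType) (P : set G) (Delta x : G) : Prop :=
  preferred_prefix P Delta x = 1.

Definition sliding_circuits (G : groupType) (P : set G) (Delta x : G) : set G :=
  [set y | conj_class x y /\
     exists m : nat, (1 <= m)%N /\ iter m (cyclic_sliding P Delta) y = y].

(* Main.v *)
Require Import Defs.
From mathcomp Require Import all_boot all_order all_algebra.
From mathcomp Require Import boolp classical_sets.
From mathcomp Require Import zify.

Import Order.TTheory Num.Theory.

Local Open Scope group_scope.
Local Open Scope classical_set_scope.

(** A rigid element is fixed by cyclic sliding, so rigid conjugates lie in SC(x).
    The converse follows a conjugator along the sliding orbit.

    Say that y divides z when y^-1 z is positive, and write D for Delta.  All
    the conjugators in play are meets of D with elements y^e D^k:
    - the preferred prefix s(y) of y, of infimum p and supremum q, is the meet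
      of D, y D^-p and y^-1 D^q;
    - the cycling conjugator c(y) is the meet of D and y D^-p;
    - the decycling conjugator d(y) is the meet of D and y^-1 D^q.
    Here p and q are kept as fixed parameters, whatever the actual infimum
    and supremum of y.  For two such operators S and T, the product of S(y) and
    T(y^S(y)) is the meet of all y^(e+e') D^(k+k'), an expression symmetric
    in S and T.  Hence these conjugations commute, and S(y) T(y^S(y)) is
    T(y) S(y^T(y)) (prefix_slideC).  Moreover S(y) divides a S(y^a) for
    positive a, because conjugation by D preserves positivity
    (prefix_transport).

    Let y lie in a sliding circuit, let p be its infimum and q its supremum, and
    let z be a rigid conjugate.  If inf z <= p and q <= sup z, choose a positive
    a with y^a rigid (after conjugating z by a power of D).  Then s(y) divides
    a s(y^a) = a, so s(y)^-1 a is a positive conjugator from the next element of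
    the orbit to the same rigid element.  It is shorter than a unless s(y) = 1.
    Lengths being finite, some element of the orbit is rigid, hence fixed by
    sliding; as y is in its orbit, y is that element
    (slides_reach_fixed_point).

    It remains to see that no conjugate of y has infimum larger than p; the
    statement on suprema follows by inverting elements.  If some conjugate has
    infimum above p, then repeated cycling raises the infimum of y
    (cycling_raises_inf).  As cycling commutes with sliding, all the cycled
    elements are sliding periodic, and it is enough to show that a single
    cycling cannot raise the infimum of a sliding periodic element u
    (cycling_keeps_inf).  Let v be the predecessor of u in its sliding orbit and
    put f = s(v)^-1 d(v), a positive element.  The cycled v has infimum above
    p, so on it sliding is decycling, and commutation gives
    c(u) = f c(v^d(v)).  If q <= p + 1, cycling u is conjugation by a power of D,
    which cannot raise the infimum.  If q >= p + 2, one checks that f = 1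
    exactly when decycling raises the infimum of v.  But f = 1 would also make
    decycling v the same as sliding v, giving u, of infimum p.  So f <> 1, the
    decycled v satisfies the same hypotheses as u, and its cycling conjugator is
    strictly shorter: an infinite descent. *)

(** * Integer powers *)

Section IntegerPowers.

Context {G : groupType}.
Implicit Types (a b g : G) (i j k : int).

Lemma expgzS a k : expgz a (k + 1)%R = expgz a k * a.
Proof.
case: k => [n|[|n]]; first by rewrite -PoszD addn1 /= expgSr.
  by rewrite /= mulVg.
have -> : (Negz n.+1 + 1)%R = Negz n by lia.
by rewrite /= -!expVgn [in RHS]expgSr mulgVK.
Qed.

Lemma expgzD a j k : expgz a (j + k)%R = expgz a j * expgz a k.
Proof.
elim/int_rect: k => [|n IH|n IH]; first by rewrite GRing.addr0 mulg1.
  by rewrite -addn1 PoszD GRing.addrA !expgzS IH mulgA.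
apply: (mulIg a); rewrite -mulgA -!expgzS.
have -> : (j - n.+1%:Z + 1)%R = (j - n%:Z)%R by lia.
by have -> : (- n.+1%:Z + 1)%R = (- n%:Z)%R by lia.
Qed.

Lemma expgzN a k : expgz a (- k)%R = (expgz a k)^-1.
Proof. by apply: (mulIg (expgz a k)); rewrite -expgzD GRing.addNr mulVg. Qed.

Lemma expgzC a j k : expgz a j * expgz a k = expgz a k * expgz a j.
Proof. by rewrite -!expgzD GRing.addrC. Qed.

Lemma expgzJ a g k : expgz (a ^ g) k = expgz a k ^ g.
Proof. by case: k => n /=; rewrite ?conjVg conjXg. Qed.

End IntegerPowers.

(** * The divisibility order *)

Section Garside.

Set Implicit Arguments.
Unset Strict Implicit.

Context {G : groupType} {P : set G} {Delta : G}.
Hypothesis hG : garside P Delta.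
Implicit Types (a b c g u v x y z : G) (i j k p q r : int).

Local Notation "a ≼ b" := (preceq P a b) (at level 70).
Local Notation D := (expgz Delta).

Lemma pos1 : P 1. Proof. by case: (garside_submonoid hG). Qed.

Lemma posM a b : P a -> P b -> P (a * b).
Proof. by case: (garside_submonoid hG) => _; apply. Qed.

Lemma pos_pointed a : P a -> P a^-1 -> a = 1.
Proof.
by move=> Pa PVa; have : (P `&` [set a | P a^-1]) a by []; rewrite (garside_pointed hG).
Qed.

Lemma posJDelta a : P (a ^ Delta) <-> P a.
Proof.
split=> Pa; last first.
  by have <- := garside_conj_Delta hG; exists a.
have: [set b ^ Delta | b in P] (a ^ Delta) by rewrite (garside_conj_Delta hG).
by case=> b Pb /conjg_inj <-.
Qed.

Lemma posJ k a : P (a ^ D k) <-> P a.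
Proof.
elim/int_rect: k a => [|n IH|n IH] a; first by rewrite [D _]/(1) conjg1.
  by rewrite -addn1 PoszD expgzS conjgM posJDelta.
rewrite -posJDelta -conjgM -expgzS.
by have -> : (- n.+1%:Z + 1)%R = (- n%:Z)%R by lia.
Qed.

Lemma pre_refl a : a ≼ a.
Proof. by rewrite /preceq mulVg; exact: pos1. Qed.

Lemma pre_trans b a c : a ≼ b -> b ≼ c -> a ≼ c.
Proof.
by move=> ab bc; rewrite /preceq -(mulVKg b c) mulgA; exact: posM.
Qed.

Lemma pre_anti a b : a ≼ b -> b ≼ a -> a = b.
Proof.
move=> ab ba; apply/esym/eqP; rewrite -(can_eq (mulKg a^-1)) mulVg; apply/eqP.
by apply: pos_pointed => //; rewrite invgM invgK.
Qed.

Lemma pre_ext a b : (forall c, c ≼ a <-> c ≼ b) -> a = b.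
Proof.
by move=> ab; apply: pre_anti; [apply/ab | apply/ab]; exact: pre_refl.
Qed.

Lemma pre_mull g a b : (g * a ≼ g * b) = (a ≼ b).
Proof. by rewrite /preceq invgM -mulgA mulKg. Qed.

Lemma pre_mullV g a b : (a ≼ g * b) = (g^-1 * a ≼ b).
Proof. by rewrite -{1}(mulVKg g a) pre_mull. Qed.

Lemma pre1 a : (1 ≼ a) = P a.
Proof. by rewrite /preceq invg1 mul1g. Qed.

Lemma pre_mulr a b : P b -> a ≼ a * b.
Proof. by rewrite -{1}(mulg1 a) pre_mull pre1. Qed.

Lemma pre_mulD k a b : (a * D k ≼ b * D k) <-> (a ≼ b).
Proof.
rewrite /preceq.
have -> : (a * D k)^-1 * (b * D k) = (a^-1 * b) ^ D k.
  by rewrite conjgE !gnorm.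
exact: posJ.
Qed.

Lemma pre_mulDV k a b : (a ≼ b * D k) <-> (a * D (- k)%R ≼ b).
Proof. by rewrite -(pre_mulD k (a * _)) expgzN mulgVK. Qed.

Lemma pre_conjD k r a : (D r ≼ a ^ D k) <-> (D r ≼ a).
Proof.
rewrite conjgE pre_mullV invgK expgzC; exact: pre_mulD.
Qed.

Lemma pre_invD k a : (D k ≼ a) <-> (a^-1 ≼ D (- k)%R).
Proof.
by rewrite -(pre_mull a a^-1) mulgV pre_mulDV GRing.opprK mul1g.
Qed.

Lemma D1 : D 1%R = Delta. Proof. by []. Qed.

Lemma pre_mulDD i j a b : D i ≼ a -> D j ≼ b -> D (i + j)%R ≼ a * b.
Proof.
move=> ia jb; apply: (pre_trans (b := a * D j)); last by rewrite pre_mull.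
by rewrite expgzD; apply/pre_mulD.
Qed.

Lemma mul_preDD i j a b : a ≼ D i -> b ≼ D j -> a * b ≼ D (i + j)%R.
Proof.
move=> ai bj; apply: (pre_trans (b := a * D j)); first by rewrite pre_mull.
by rewrite expgzD; apply/pre_mulD.
Qed.

Lemma invD_pre k a : (a ≼ D k) <-> (D (- k)%R ≼ a^-1).
Proof. by rewrite pre_invD GRing.opprK invgK. Qed.

Lemma preD i j : (i <= j)%R -> D i ≼ D j.
Proof.
move=> ij; have -> : j = (i + `|j - i|%N)%R by lia.
rewrite expgzD; apply: pre_mulr; elim: `|j - i|%N => [|n IH]; first exact: pos1.
by rewrite -addn1 PoszD expgzS; apply: posM => //; exact: (garside_Delta hG).
Qed.

(** The elements lying between two powers of Delta form a subgroup containing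
    the simple elements. *)
Lemma pre_boundedD a : exists p q, D p ≼ a /\ a ≼ D q.
Proof.
pose B := [set a | exists p q, D p ≼ a /\ a ≼ D q].
suff : smallest (@subgroup G) (simples P Delta) `<=` B.
  by rewrite (garside_generate hG); apply.
apply: smallest_sub => [|b [b1 b2]]; last by exists 0%R, 1%R.
split=> [|u v [i [j [iu uj]]] [k [l [kv vl]]]].
  by exists 0%R, 0%R; split; exact: pre_refl.
exists (i - l)%R, (j - k)%R; split.
  by apply: pre_mulDD => //; apply/invD_pre.
by apply: mul_preDD => //; apply/pre_invD.
Qed.

(** * Lengths of positive elements *)

(** A bound on the number of nontrivial positive factors; it replaces the norm
    of an element, so that descents need no supremum. *)
Definition bounded N a := forall k : nat, factorization_lengths P a k -> (k <= N)%N.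

Lemma pos_prod (s : seq G) : (forall a, a \in s -> P a /\ a <> 1) -> P (\prod_(a <- s) a).
Proof.
elim: s => [|a s IH] h; first by rewrite big_nil; exact: pos1.
rewrite big_cons; apply: posM; first by case: (h a (mem_head _ _)).
by apply: IH => b bs; apply: h; rewrite in_cons bs orbT.
Qed.

Lemma exists_bounded a : P a -> exists N, bounded N a.
Proof.
have [-> _|a1 Pa] := pselect (a = 1); last exact: (garside_norm hG).
exists 0%N => k [[|b s] [<- h e]] //.
have [Pb b1] := h b (mem_head _ _).
case: b1; apply: pos_pointed => //.
move: e; rewrite big_cons => /esym/mulg1_eq ->.
by apply: pos_prod => c cs; apply: h; rewrite in_cons cs orbT.
Qed.

Lemma factorization_lengthsM a b (j k : nat) :
  factorization_lengths P a j -> factorization_lengths P b k ->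
  factorization_lengths P (a * b) (j + k).
Proof.
move=> [s [<- hs ->]] [t [<- ht ->]]; exists (s ++ t); rewrite size_cat big_cat.
by split=> // c; rewrite mem_cat => /orP[/hs|/ht].
Qed.

Lemma factorization_lengths1 a : P a -> a <> 1 -> factorization_lengths P a 1%N.
Proof.
move=> Pa a1; exists [:: a]; rewrite big_seq1; split=> // c.
by rewrite mem_seq1 => /eqP ->.
Qed.

Lemma factorization_lengths_inh a : P a -> exists k : nat, factorization_lengths P a k.
Proof.
have [-> _|a1 Pa] := pselect (a = 1); last by exists 1%N; exact: factorization_lengths1.
by exists 0%N, [::]; rewrite big_nil.
Qed.

(** The form in which lengths enter every descent: removing a nontrivial
    positive factor lowers the bound. *)
Lemma bounded_mull N a b : P a -> a <> 1 -> P b -> bounded N (a * b) ->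
  exists2 M, N = M.+1 & bounded M b.
Proof.
move=> /factorization_lengths1 h /h{h} ha /factorization_lengths_inh[j hj].
move=> hN; have := hN _ (factorization_lengthsM ha hj).
case: N hN => // N hN _; exists N => // k hk.
exact: hN _ (factorization_lengthsM ha hk).
Qed.

Lemma bounded_mulr N a b : P a -> P b -> b <> 1 -> bounded N (a * b) ->
  exists2 M, N = M.+1 & bounded M a.
Proof.
move=> /factorization_lengths_inh[j hj] /factorization_lengths1 h /h{h} hb.
move=> hN; have := hN _ (factorization_lengthsM hj hb).
rewrite addn1; case: N hN => // N hN _; exists N => // k hk.
by have := hN _ (factorization_lengthsM hk hb); rewrite addn1.
Qed.

Lemma boundedJ N k a : bounded N a -> bounded N (a ^ D k).
Proof.
move=> hN _ [s [<- hs e]]; apply: hN; exists [seq b ^ D (- k)%R | b <- s].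
rewrite size_map big_map; split=> //.
  move=> _ /mapP[b /hs[Pb b1] ->]; split; first by apply/posJ.
  by move/eqP; rewrite conjg_eq1 => /eqP.
by rewrite -conjg_prod -e expgzN conjgK.
Qed.

(** * Prefixes and slides *)

Lemma ggcdP a b c : (c ≼ ggcd P a b) <-> (c ≼ a /\ c ≼ b).
Proof.
have [da db h] : is_gcd P a b (ggcd P a b).
  by have [d hd] := garside_gcd hG a b; exact: (xgetI _ hd).
split=> [cd|[]]; last exact: h.
by split; [exact: pre_trans cd da|exact: pre_trans cd db].
Qed.

Definition slot y (e : int * int) := expgz y e.1 * D e.2.

(** The meets of Delta with a finite family of elements y^e Delta^k, given by
    their exponents (e, k).  Cycling, decycling and sliding conjugators are all
    of this shape.  Left multiplication by y and right multiplication by Delta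
    act on the exponents, which reduces identities between the conjugators to
    additions of exponents. *)
Definition prefix (S : seq (int * int)) y :=
  foldr (fun e g => ggcd P (slot y e) g) Delta S.

Definition slide S y := y ^ prefix S y.

Implicit Types (S T : seq (int * int)).

Notation slots S := ((0%R, 1%R) :: S).

Lemma prefixP S y c : (c ≼ prefix S y) <-> (forall e, e \in slots S -> c ≼ slot y e).
Proof.
elim: S => [|f S IH] /=.
  split=> [h e|h]; first by rewrite mem_seq1 => /eqP ->; rewrite /slot mul1g.
  by have := h _ (mem_head _ _); rewrite /slot mul1g.
rewrite ggcdP IH; split=> [[h1 h2] e|h].
  rewrite !inE => /or3P[/eqP->|/eqP->//|eS]; apply: h2; rewrite inE ?eqxx //.
  by rewrite eS orbT.
split=> [|e]; first by apply: h; rewrite !inE eqxx orbT.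
by rewrite inE => /orP[/eqP->|eS]; apply: h; rewrite !inE ?eqxx ?eS ?orbT.
Qed.

Lemma prefix_pre S y e : e \in slots S -> prefix S y ≼ slot y e.
Proof. by move: e; apply/prefixP; exact: pre_refl. Qed.

Lemma prefix_pre_Delta S y : prefix S y ≼ Delta.
Proof. by have := prefix_pre y (mem_head _ S); rewrite /slot mul1g. Qed.

(** Translations on the left, and right multiplication by powers of Delta,
    commute with meets. *)
Lemma prefix_shiftP S y i k c :
  (c ≼ expgz y i * prefix S y * D k) <->
  (forall e, e \in slots S -> c ≼ expgz y (i + e.1)%R * D (e.2 + k)%R).
Proof.
rewrite pre_mulDV pre_mullV prefixP.
have E e : ((expgz y i)^-1 * (c * D (- k)) ≼ slot y e) <->
    (c ≼ expgz y (i + e.1)%R * D (e.2 + k)%R).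
  by rewrite -pre_mullV -pre_mulDV /slot !expgzD !mulgA.
by split=> h e /h /E.
Qed.

(** Conjugating y by a turns a (y^a)^e Delta^k into y^e a Delta^k: the factor a moves
    between the power of y and the power of Delta, where positivity of a can
    be used. *)
Lemma prefix_conjP S a y c :
  (c ≼ a * prefix S (y ^ a)) <->
  (forall e, e \in slots S -> c ≼ expgz y e.1 * a * D e.2).
Proof.
rewrite pre_mullV prefixP.
have E e : (a^-1 * c ≼ slot (y ^ a) e) <-> (c ≼ expgz y e.1 * a * D e.2).
  by rewrite -pre_mullV /slot expgzJ conjgE !mulgA mulgV mul1g.
by split=> h e /h /E.
Qed.

(** Both sides are the meet of the y^(e+e') Delta^(k+k'), for (e, k) ranging over
    the exponents of S and (e', k') over those of T. *)
Lemma prefix_slideC S T y :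
  prefix S y * prefix T (slide S y) = prefix T y * prefix S (slide T y).
Proof.
have half U V c : c ≼ prefix U y * prefix V (slide U y) ->
    c ≼ prefix V y * prefix U (slide V y).
  rewrite !prefix_conjP => h e eU; apply/prefix_shiftP => f fV.
  have /prefix_shiftP/(_ e eU) := h f fV.
  by rewrite [(f.1 + _)%R]GRing.addrC [(_ + f.2)%R]GRing.addrC.
by apply: pre_ext => c; split; exact: half.
Qed.

Lemma slideC S T y : slide T (slide S y) = slide S (slide T y).
Proof. by rewrite /slide -!conjgM -!/(slide _ _) prefix_slideC. Qed.

Lemma iter_slideC n S T y : iter n (slide S) (slide T y) = slide T (iter n (slide S) y).
Proof. by elim: n => //= n ->; rewrite slideC. Qed.

(** A positive a conjugating y to z yields the conjugator
    prefix S y^-1 * a * prefix S z from slide S y to slide S z; the lemma says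
    that it is again positive. *)
Lemma prefix_transport S a y : P a -> prefix S y ≼ a * prefix S (y ^ a).
Proof.
move=> Pa; apply/prefix_conjP => e eS; apply: (pre_trans (prefix_pre y eS)).
by rewrite /slot pre_mulD; exact: pre_mulr.
Qed.

Lemma prefix_conjD S k y : D k * prefix S (y ^ D k) = prefix S y * D k.
Proof.
apply: pre_ext => c; rewrite prefix_conjP.
have := prefix_shiftP S y 0%R k c; rewrite mul1g => ->.
have E e : expgz y (0 + e.1)%R * D (e.2 + k)%R = expgz y e.1 * D k * D e.2.
  by rewrite GRing.add0r -mulgA -expgzD GRing.addrC.
by split=> h e /h; rewrite E.
Qed.

(** Write d for the prefix.  It divides y^e Delta^k, so d Delta^r divides
    y^e Delta^r Delta^k, hence y^e y Delta^k; the meet of the latter is y d. *)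
Lemma preD_slide S r y : D r ≼ y -> D r ≼ slide S y.
Proof.
move=> ry; rewrite /slide conjgE pre_mullV invgK.
rewrite -[y * _]mulg1 -[X in _ ≼ X]/(expgz y 1%R * prefix S y * D 0%R).
apply/prefix_shiftP => e eS.
apply: (pre_trans (b := slot y e * D r)); first exact/pre_mulD/prefix_pre.
rewrite /slot -mulgA expgzC mulgA GRing.addr0 pre_mulD GRing.addrC expgzD.
by rewrite pre_mull.
Qed.

Lemma slide_preD S r y : y ≼ D r -> slide S y ≼ D r.
Proof.
move=> yr; rewrite /slide conjgE -(mulKg (prefix S y) (D r)) pre_mull.
rewrite -[prefix S y * _]mul1g mulgA -[X in _ ≼ X]/(expgz y 0%R * prefix S y * D r).
apply/prefix_shiftP => e eS.
apply: (pre_trans (b := y * slot y e)); first by rewrite pre_mull; exact: prefix_pre.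
rewrite /slot GRing.add0r mulgA GRing.addrC expgzD mulgA pre_mulD.
by rewrite (expgzC y 1%R e.1 : y * _ = _ * y) pre_mull.
Qed.

Lemma preD_iter_slide n S r y : D r ≼ y -> D r ≼ iter n (slide S) y.
Proof. by elim: n => //= n IH /IH; exact: preD_slide. Qed.

Lemma iter_slide_preD n S r y : y ≼ D r -> iter n (slide S) y ≼ D r.
Proof. by elim: n => //= n IH /IH; exact: slide_preD. Qed.

(** * Cycling, decycling and sliding with prescribed bounds *)

Local Notation cyc p := [:: (1%R, (- p)%R)].
Local Notation dec q := [:: ((-1)%R, q)].
Local Notation sli p q := [:: (1%R, (- p)%R); ((-1)%R, q)].

Lemma cycP p y c : (c ≼ prefix (cyc p) y) <-> (c ≼ Delta /\ c ≼ y * D (- p)%R).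
Proof.
rewrite prefixP; split=> [h|[h1 h2] e].
  split; last by apply: (h (1%R, _)); rewrite !inE eqxx orbT.
  by have := h _ (mem_head _ _); rewrite /slot mul1g.
by rewrite !inE => /orP[] /eqP -> //; rewrite /slot mul1g.
Qed.

Lemma decP q y c : (c ≼ prefix (dec q) y) <-> (c ≼ Delta /\ c ≼ y^-1 * D q).
Proof.
rewrite prefixP; split=> [h|[h1 h2] e].
  split; last by apply: (h ((-1)%R, _)); rewrite !inE eqxx orbT.
  by have := h _ (mem_head _ _); rewrite /slot mul1g.
by rewrite !inE => /orP[] /eqP -> //; rewrite /slot mul1g.
Qed.

Lemma sliP p q y c :
  (c ≼ prefix (sli p q) y) <-> [/\ c ≼ Delta, c ≼ y * D (- p)%R & c ≼ y^-1 * D q].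
Proof.
rewrite prefixP; split=> [h|[h1 h2 h3] e].
  split; first by have := h _ (mem_head _ _); rewrite /slot mul1g.
    by apply: (h (1%R, _)); rewrite !inE eqxx orbT.
  by apply: (h ((-1)%R, _)); rewrite !inE eqxx !orbT.
by rewrite !inE => /or3P[] /eqP -> //; rewrite /slot mul1g.
Qed.

Lemma pre_slot1 p y : (1 ≼ y * D (- p)%R) <-> (D p ≼ y).
Proof. by rewrite pre_mulDV GRing.opprK mul1g. Qed.

Lemma pre_slotN1 q y : (1 ≼ y^-1 * D q) <-> (y ≼ D q).
Proof. by rewrite pre_mullV invgK mulg1. Qed.

Lemma pos_Delta : P Delta. Proof. exact: (garside_Delta hG). Qed.

Lemma pos_prefix_cyc p y : D p ≼ y -> P (prefix (cyc p) y).
Proof. by rewrite -(pre1 (prefix _ _)) cycP pre1 pre_slot1; split=> //; exact: pos_Delta. Qed.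

Lemma pos_prefix_sli p q y : D p ≼ y -> y ≼ D q -> P (prefix (sli p q) y).
Proof.
move=> py yq; rewrite -pre1; apply/sliP; split; first by rewrite pre1; exact: pos_Delta.
  exact/pre_slot1.
exact/pre_slotN1.
Qed.

(** The argument of Elrifai and Morton.  Let i be the cycling conjugator of y and
    z = b y b^-1.  Since Delta^(p+1) divides z, Delta divides
    b y Delta^-p = z b Delta^-p; it also divides b Delta, hence the meet b i, say
    b i = Delta g.  The cycled y is then conjugated by g^-1 to a conjugate of z by Delta.  And g is, up
    to conjugation by Delta, a proper left factor of b, whose cofactor
    Delta i^-1 is trivial only if the infimum of y is already above p. *)
Lemma cycling_raises_inf N b p y : P b -> bounded N b -> D p ≼ y ->
  D (p + 1)%R ≼ y ^ b^-1 -> exists k : nat, D (p + 1)%R ≼ iter k (slide (cyc p)) y.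
Proof.
elim/ltn_ind: N b y => N IH b y Pb hb py hz.
have [hy|hy] := pselect (D (p + 1)%R ≼ y); first by exists 0%N.
pose i := prefix (cyc p) y; pose g := Delta^-1 * (b * i).
have Pg : P g.
  rewrite -[P g]/(Delta ≼ b * i) pre_mullV; apply/cycP; split.
    by rewrite -pre_mullV -{1}(mul1g Delta) -D1 pre_mulD pre1.
  rewrite -pre_mullV mulgA; apply/pre_mulDV; rewrite GRing.opprK -D1 -expgzD GRing.addrC.
  apply: (pre_trans hz); rewrite conjgE invgK -(mulgVK b (b * y)) mulgA.
  exact: pre_mulr.
have PiD : P (Delta * i^-1).
  by apply/posJDelta; rewrite conjgE -mulgA mulKg; exact: prefix_pre_Delta.
have iD : Delta * i^-1 <> 1.
  move/divg1_eq => iD; apply: hy; rewrite GRing.addrC expgzD.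
  have : Delta ≼ i by rewrite iD; exact: pre_refl.
  by move/cycP => [_]; rewrite pre_mulDV GRing.opprK.
have eb : b = (g ^ D (-1)%R) * (Delta * i^-1).
  by rewrite conjgE expgzN D1 invgK /g !mulgA mulgV mul1g !gnorm.
have Pg' : P (g ^ D (-1)%R) by apply/posJ.
move: hb; rewrite eb => hb.
have [M eN hM] := bounded_mulr Pg' PiD iD hb.
have hg : bounded M g by rewrite -(conjgK (D 1) g) -expgzN -conjgM expgzC conjgM; apply: boundedJ.
have [|||k hk] := IH M _ g (slide (cyc p) y) Pg hg; first by rewrite eN.
- exact: preD_slide.
- rewrite /slide -/i -conjgM.
  have -> : i * g^-1 = b^-1 * Delta by rewrite /g !invgM invgK !mulgA mulgV mul1g.
  by rewrite conjgM -D1; apply/pre_conjD.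
by exists k.+1; rewrite iterSr.
Qed.

Lemma prefix_sli_dec p q y : prefix (dec q) y ≼ y * D (- p)%R ->
  prefix (sli p q) y = prefix (dec q) y.
Proof.
move=> h; apply: pre_ext => c; rewrite sliP decP; split=> [[]//|[cD cq]].
by split=> //; apply: pre_trans h; apply/decP.
Qed.

Lemma prefix_sli_dec_high p q y : D (p + 1)%R ≼ y ->
  prefix (sli p q) y = prefix (dec q) y.
Proof.
move=> hy; apply: prefix_sli_dec; apply: pre_trans (prefix_pre_Delta _ _) _.
by apply/pre_mulDV; rewrite GRing.opprK -D1 -expgzD GRing.addrC.
Qed.

Lemma preD_slideP S r y : (D r ≼ slide S y) <-> (prefix S y * D r ≼ y * prefix S y).
Proof. by rewrite /slide conjgE (pre_mullV (prefix S y)^-1) invgK. Qed.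

(** With d the decycling conjugator, d Delta^(p+1) divides y d, which divides
    y Delta; cancel Delta. *)
Lemma prefix_dec_of_decycling_raises_inf p q y : D (p + 1)%R ≼ slide (dec q) y ->
  prefix (dec q) y ≼ y * D (- p)%R.
Proof.
move=> /preD_slideP h; apply/pre_mulDV; rewrite GRing.opprK.
apply/(pre_mulD 1%R); rewrite -mulgA -expgzD; apply: (pre_trans h).
by rewrite pre_mull; exact: prefix_pre_Delta.
Qed.

(** Converse of the previous lemma.  Write d for the decycling conjugator: y d is
    the meet of y Delta and Delta^q.  The hypothesis bounds d Delta^(p+1) by
    the first; it divides Delta^(p+2), hence the second, since p + 2 <= q. *)
Lemma decycling_raises_inf p q y : (p + 2 <= q)%R ->
  prefix (dec q) y ≼ y * D (- p)%R -> D (p + 1)%R ≼ slide (dec q) y.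
Proof.
move=> pq h; apply/preD_slideP; rewrite pre_mullV; apply/decP; rewrite -!pre_mullV mulVKg.
split.
  rewrite expgzD mulgA -D1 pre_mulD; apply: pre_trans (proj2 (pre_mulD p _ _) h) _.
  by rewrite expgzN mulgVK; exact: pre_refl.
apply: pre_trans (proj2 (pre_mulD (p + 1)%R _ _) (prefix_pre_Delta _ _)) _.
by rewrite -{1}D1 -expgzD; apply: preD; lia.
Qed.

(** When q <= p + 1, y Delta^-p divides Delta, so it is the cycling conjugator and
    cycling is conjugation by a power of Delta. *)
Lemma cycling_keeps_inf_short p q y : (q <= p + 1)%R -> y ≼ D q ->
  D (p + 1)%R ≼ slide (cyc p) y -> D (p + 1)%R ≼ y.
Proof.
move=> qp yq; rewrite /slide.
have -> : prefix (cyc p) y = y * D (- p)%R.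
  apply: pre_ext => c; rewrite cycP; split=> [[]//|h]; split=> //.
  apply: (pre_trans h); apply/(pre_mulD p); rewrite expgzN mulgVK -{1}D1 -expgzD.
  by apply: (pre_trans yq); apply: preD; lia.
by rewrite conjgM pre_conjD conjgE mulKg.
Qed.

(** Infinite descent on the length of the cycling conjugator of y, passing from y
    to the decycling of its predecessor v in the sliding orbit. *)
Lemma cycling_keeps_inf N p q m y : D p ≼ y -> y ≼ D q ->
  iter m.+1 (slide (sli p q)) y = y -> bounded N (prefix (cyc p) y) ->
  D (p + 1)%R ≼ slide (cyc p) y -> D (p + 1)%R ≼ y.
Proof.
move=> py yq per hN hc.
have [qp|pq] := lerP q (p + 1)%R; first exact: cycling_keeps_inf_short qp yq hc.
have {}pq : (p + 2 <= q)%R by lia.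
elim/ltn_ind: N y py yq per hN hc => N IH y py yq per hN hc.
have [//|hy] := pselect (D (p + 1)%R ≼ y).
pose v := iter m (slide (sli p q)) y.
have sv : slide (sli p q) v = y by [].
have pv : D p ≼ v by exact: preD_iter_slide.
have vq : v ≼ D q by exact: iter_slide_preD.
have cv : D (p + 1)%R ≼ slide (cyc p) v.
  by rewrite -iter_slideC; exact: preD_iter_slide.
have perv : iter m.+1 (slide (sli p q)) v = v by rewrite iterSr sv.
clearbody v.
have pvd : prefix (sli p q) v ≼ prefix (dec q) v.
  by apply/decP; have /sliP[] := pre_refl (prefix (sli p q) v).
pose f := (prefix (sli p q) v)^-1 * prefix (dec q) v.
(* f = 1 would make y = v^s(v) = v^d(v), whose infimum is above p *)
have f1 : f <> 1.
  move/mulg1_eq; rewrite invgK => e; apply: hy; rewrite -sv /slide e.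
  apply: decycling_raises_inf => //; rewrite -e.
  by have /sliP[] := pre_refl (prefix (sli p q) v).
have dv : ~ (D (p + 1)%R ≼ slide (dec q) v).
  move=> h; apply: f1; rewrite /f (@prefix_sli_dec p q) ?mulVg //.
  exact: prefix_dec_of_decycling_raises_inf.
(* commutation of sliding and of decycling with cycling; these two agree at
   slide (cyc p) v, whose infimum is above p *)
have e : prefix (cyc p) y = f * prefix (cyc p) (slide (dec q) v).
  apply: (mulgI (prefix (sli p q) v)); rewrite /f -mulgA mulVKg.
  have := prefix_slideC (sli p q) (cyc p) v.
  by rewrite sv (prefix_sli_dec_high q cv) prefix_slideC.
have pdv : D p ≼ slide (dec q) v by exact: preD_slide.
have Pc := pos_prefix_cyc pdv.
move: hN; rewrite e => hN.
have [M eN hM] := bounded_mull pvd f1 Pc hN.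
case: dv; apply: (IH M) => //; first by rewrite eN.
- exact: slide_preD.
- by rewrite iter_slideC perv.
- by rewrite slideC; exact: preD_slide.
Qed.

(** All the iterated cyclings of y are sliding periodic, so the bound
    reached after k cyclings is carried back to y one cycling at a time. *)
Lemma sliding_periodic_inf_max p q m y z : D p ≼ y -> y ≼ D q ->
  iter m.+1 (slide (sli p q)) y = y -> conj_class y z ->
  D (p + 1)%R ≼ z -> D (p + 1)%R ≼ y.
Proof.
move=> py yq per [g _ gz] hz.
have [j [_ [jg _]]] := pre_boundedD g^-1.
have [N hN] := exists_bounded jg.
have [|k] := cycling_raises_inf jg hN py.
  by rewrite invgM !invgK conjgM gz; apply/pre_conjD.
elim: k => //= k IH hk; apply: IH.
set u := iter k _ _ in hk *.
have pu : D p ≼ u by exact: preD_iter_slide.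
have uq : u ≼ D q by exact: iter_slide_preD.
have [M hM] := exists_bounded (pos_prefix_cyc pu).
apply: (cycling_keeps_inf (m := m) pu uq _ hM hk).
rewrite /u; elim: (k) => [|k' IHk]; first exact: per.
by rewrite [iter k'.+1 _ _]iterS iter_slideC IHk.
Qed.

(** Inversion exchanges the bounds p and q, up to sign, but keeps the sliding
    conjugator; this deduces the statement on suprema from that on infima. *)
Lemma prefix_sliV p q y : prefix (sli p q) y^-1 = prefix (sli (- q)%R (- p)%R) y.
Proof.
by apply: pre_ext => c; rewrite !sliP invgK GRing.opprK; split=> -[].
Qed.

Lemma iter_sliV n p q y :
  iter n (slide (sli p q)) y^-1 = (iter n (slide (sli (- q)%R (- p)%R)) y)^-1.
Proof. by elim: n => //= n ->; rewrite /slide prefix_sliV conjVg. Qed.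

Lemma sliding_periodic_sup_min p q m y z : D p ≼ y -> y ≼ D q ->
  iter m.+1 (slide (sli p q)) y = y -> conj_class y z ->
  z ≼ D (q - 1)%R -> y ≼ D (q - 1)%R.
Proof.
move=> py yq per [g _ gz] hz.
have E : (- (q - 1))%R = (- q + 1)%R by lia.
apply/invD_pre; rewrite E; apply: (@sliding_periodic_inf_max _ (- p)%R m _ z^-1).
- exact/invD_pre.
- exact/pre_invD.
- by rewrite iter_sliV !GRing.opprK per.
- by exists g => //; rewrite -gz conjVg.
- by rewrite -E; apply/invD_pre.
Qed.

(** * Sliding towards a rigid element *)

(** The product of the successive sliding conjugators always divides a, whose
    length is finite.  The bounds p' and q' of the rigid element y ^ a may
    be weaker than p and q, which makes its prefix for p and q trivial too. *)
Lemma slides_reach_fixed_point N a p q p' q' y : (p' <= p)%R -> (q <= q')%R ->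
  D p ≼ y -> y ≼ D q -> P a -> bounded N a -> prefix (sli p' q') (y ^ a) = 1 ->
  exists n : nat, prefix (sli p q) (iter n (slide (sli p q)) y) = 1.
Proof.
move=> pp qq; elim/ltn_ind: N a y => N IH a y py yq Pa hN hz.
have [y1|y1] := pselect (prefix (sli p q) y = 1); first by exists 0%N.
have pa : prefix (sli p q) y ≼ a.
  apply: (pre_trans (prefix_transport _ _ Pa)).
  rewrite -{3}(mulg1 a) pre_mull -hz; apply/sliP.
  have /sliP[zD zp zq] := pre_refl (prefix (sli p q) (y ^ a)).
  split=> //; [apply: (pre_trans zp)|apply: (pre_trans zq)];
    by rewrite pre_mull; apply: preD; lia.
have Ps := pos_prefix_sli py yq.
move: hN; rewrite -(mulVKg (prefix (sli p q) y) a) => hN.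
have [M eN hM] := bounded_mull Ps y1 pa hN.
have MN : (M < N)%N by rewrite eN.
have hz' : prefix (sli p' q') (slide (sli p q) y ^ ((prefix (sli p q) y)^-1 * a)) = 1.
  by rewrite {1}/slide -conjgM mulVKg.
have [n hn] := IH M MN _ _ (preD_slide _ py) (slide_preD _ yq) pa hM hz'.
by exists n.+1; rewrite iterSr.
Qed.

(** * Infimum, supremum and cyclic sliding *)

(** The extremal exponents defining the infimum and the supremum exist only when
    Delta is nontrivial; otherwise the group is trivial. *)
Lemma trivial_of_Delta1 a : Delta = 1 -> a = 1.
Proof.
move=> Delta1; have Dk k : D k = 1 by rewrite Delta1; case: k => n /=; rewrite expg1n ?invg1.
have [p [q []]] := pre_boundedD a; rewrite !Dk pre1 /preceq mulg1.
exact: pos_pointed.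
Qed.

Section NontrivialDelta.

Hypothesis Delta1 : Delta <> 1.

Lemma preD_le i j : D i ≼ D j -> (i <= j)%R.
Proof.
move=> ij; rewrite leNgt; apply/negP => ji; apply: Delta1.
apply: pos_pointed; first exact: pos_Delta.
have : D (j - i)%R = 1.
  apply: pos_pointed; first by rewrite GRing.addrC expgzD expgzN.
  by rewrite -expgzN -pre1; apply: (@preD 0%R); lia.
have -> : (j - i)%R = (- (i - j - 1) - 1)%R by lia.
rewrite expgzD !expgzN D1 => /divg1_eq <-; rewrite invgK.
by rewrite -pre1; apply: (@preD 0%R); lia.
Qed.

Lemma ginfP y : D (ginf P Delta y) ≼ y /\ (forall k, D k ≼ y -> (k <= ginf P Delta y)%R).
Proof.
suff [k hk] : exists k, D k ≼ y /\ (forall q, D q ≼ y -> (q <= k)%R).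
  by rewrite /ginf; case: xgetP => [k' _ //|/(_ k)/(_ hk)].
have [p [q [py yq]]] := pre_boundedD y.
have : forall k, D k ≼ y -> (k <= p + `|q - p|%N)%R.
  by move=> k ky; have := preD_le (pre_trans ky yq); lia.
elim: `|q - p|%N => [|n IH] h; first by exists p; split=> // k /h; lia.
have [hn|hn] := pselect (D (p + n.+1)%R ≼ y); first by exists (p + n.+1)%R.
apply: IH => k ky; have := h k ky; case: (k =P (p + n.+1)%R) => [e|]; last by lia.
by rewrite e in ky.
Qed.

Lemma gsupP y : y ≼ D (gsup P Delta y) /\ (forall k, y ≼ D k -> (gsup P Delta y <= k)%R).
Proof.
suff [k hk] : exists k, y ≼ D k /\ (forall q, y ≼ D q -> (k <= q)%R).
  by rewrite /gsup; case: xgetP => [k' _ //|/(_ k)/(_ hk)].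
have [iy hy] := ginfP y^-1; exists (- ginf P Delta y^-1)%R; split.
  by apply/invD_pre; rewrite GRing.opprK.
by move=> q /invD_pre/hy; lia.
Qed.

Lemma preferred_prefixE y :
  preferred_prefix P Delta y = prefix (sli (ginf P Delta y) (gsup P Delta y)) y.
Proof.
by apply: pre_ext => c; rewrite sliP /preferred_prefix !ggcdP; split=> [[[]]|[]].
Qed.

Lemma cyclic_slidingE y :
  cyclic_sliding P Delta y = slide (sli (ginf P Delta y) (gsup P Delta y)) y.
Proof. by rewrite /cyclic_sliding preferred_prefixE. Qed.

Local Notation cs := (cyclic_sliding P Delta).

Lemma ginf_iter n y : (ginf P Delta y <= ginf P Delta (iter n cs y))%R.
Proof.
elim: n => //= n IH; apply: (le_trans IH); apply: (ginfP _).2.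
by rewrite cyclic_slidingE; apply: preD_slide; exact: (ginfP _).1.
Qed.

Lemma gsup_iter n y : (gsup P Delta (iter n cs y) <= gsup P Delta y)%R.
Proof.
elim: n => //= n IH; apply: le_trans IH; apply: (gsupP _).2.
by rewrite cyclic_slidingE; apply: slide_preD; exact: (gsupP _).1.
Qed.

Lemma iter_periodic m n y : iter m.+1 cs y = y ->
  exists k : nat, iter k cs (iter n cs y) = y.
Proof.
move=> per; exists (n * m)%N; rewrite -iterD addnC -mulnS.
by elim: n => [|n IH] //; rewrite mulSn iterD IH.
Qed.

(** Along a periodic orbit the infimum, which never decreases, and the supremum,
    which never increases, are constant. *)
Lemma iter_cyclic_sliding m n y : iter m.+1 cs y = y ->
  let S := sli (ginf P Delta y) (gsup P Delta y) in
  iter n cs y = iter n (slide S) y /\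
  preferred_prefix P Delta (iter n cs y) = prefix S (iter n cs y).
Proof.
move=> per S.
have E (k : nat) : preferred_prefix P Delta (iter k cs y) = prefix S (iter k cs y).
  have [l hl] := iter_periodic k per.
  rewrite preferred_prefixE.
  have -> : ginf P Delta (iter k cs y) = ginf P Delta y.
    by apply/le_anti; rewrite ginf_iter -{2}hl ginf_iter.
  have -> // : gsup P Delta (iter k cs y) = gsup P Delta y.
  by apply/le_anti; rewrite gsup_iter -{1}hl gsup_iter.
split=> //; elim: n => //= n <-; by rewrite {1}/cyclic_sliding E.
Qed.

Lemma sliding_circuit_rigid m y z : iter m.+1 cs y = y -> conj_class y z ->
  rigid P Delta z -> rigid P Delta y.
Proof.
move=> per yz zr.
have [py pmax] := ginfP y; have [yq qmin] := gsupP y.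
have [pz _] := ginfP z; have [zq _] := gsupP z.
have [per' _] := iter_cyclic_sliding m.+1 per; rewrite per in per'.
have pp : (ginf P Delta z <= ginf P Delta y)%R.
  rewrite leNgt; apply/negP => h.
  have := sliding_periodic_inf_max py yq (esym per') yz (pre_trans (preD _) pz).
  by move=> /(_ ltac:(lia))/pmax; lia.
have qq : (gsup P Delta y <= gsup P Delta z)%R.
  rewrite leNgt; apply/negP => h.
  have := sliding_periodic_sup_min py yq (esym per') yz (pre_trans zq (preD _)).
  by move=> /(_ ltac:(lia))/qmin; lia.
have [g _ gz] := yz.
have [k [_ [kg _]]] := pre_boundedD g.
(* right multiplication by a power of Delta makes the conjugator positive and
   keeps the target rigid *)
have Pa : P (g * D (- k)%R) by rewrite -pre1 pre_slot1.
have [N hN] := exists_bounded Pa.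
have za : prefix (sli (ginf P Delta z) (gsup P Delta z)) (y ^ (g * D (- k)%R)) = 1.
  rewrite conjgM gz; apply: (mulgI (D (- k)%R)).
  by rewrite prefix_conjD -preferred_prefixE zr mul1g mulg1.
have [n hn] := slides_reach_fixed_point pp qq py yq Pa hN za.
have [en] := iter_cyclic_sliding n per; rewrite -en in hn; rewrite hn => {en} hn'.
have [l <-] := iter_periodic n per.
have fixn : cs (iter n cs y) = iter n cs y.
  by rewrite [LHS]/cyclic_sliding hn' conjg1.
suff -> : iter l cs (iter n cs y) = iter n cs y by [].
by elim: l => //= l ->.
Qed.

End NontrivialDelta.

End Garside.

Theorem theorem1p1 (G : groupType) (P : set G) (Delta : G)
  (hG : garside_finite_type P Delta) (x : G)
  (hx : exists y : G, conj_class x y /\ rigid P Delta y) :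
  sliding_circuits P Delta x = [set y | conj_class x y /\ rigid P Delta y].
Proof.
have [gars _] := hG; apply/seteqP; split=> y [xy].
  case=> -[|m] [// _ per]; split=> //.
  have [Delta1|Delta1] := pselect (Delta = 1); first exact: (trivial_of_Delta1 gars).
  have [z [[g _ gz] zr]] := hx; have [h _ hy] := xy.
  apply: (sliding_circuit_rigid gars Delta1 per _ zr).
  by exists (h^-1 * g) => //; rewrite -hy -conjgM mulVKg.
move=> yr; split=> //; exists 1%N; split=> //.
by rewrite /= /cyclic_sliding yr conjg1.
Qed.
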